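(* Let $T$ be a string of length $n$ over an alphabet $\Sigma$, and let $T'$ be any string with edit distance $\mathrm{ed}(T,T')=1$ (so $T'$ is obtained from $T$ by a single character insertion, deletion, or substitution; $|T'|\in\{n+1,n-1,n\}$ accordingly). Then $$\mathsf{size}(T') \le 8\,\mathsf{size}(T)+4 .$$ Consequently, for the worst-case multiplicative sensitivities $\mathrm{MS}_{\mathrm{ins}}(\mathsf{size},n)$, $\mathrm{MS}_{\mathrm{del}}(\mathsf{size},n)$, $\mathrm{MS}_{\mathrm{sub}}(\mathsf{size},n)$, every ratio $\mathsf{size}(T')/\mathsf{size}(T)$ over which these maxima are taken is at most $(8\,\mathsf{size}(T)+4)/\mathsf{size}(T)$.
   Context: Strings are over a finite alphabet $\Sigma$. For a string $T$, $\mathrm{Substr}(T)$, $\mathrm{Prefix}(T)$, $\mathrm{Suffix}(T)$ denote its sets of substrings, prefixes and suffixes (each including the empty string $\varepsilon$). A string $w\in\mathrm{Substr}(T)$ is left-maximal in $T$ if $w\in\mathrm{Prefix}(T)$ or there exist distinct characters $a,b\in\Sigma$ with $aw,bw\in\mathrm{Substr}(T)$; it is right-maximal in $T$ if $w\in\mathrm{Suffix}(T)$ or there exist distinct $a,b\in\Sigma$ with $wa,wb\in\mathrm{Substr}(T)$. Let $\mathsf{LeftM}(T)$, $\mathsf{RightM}(T)$ be the sets of left-maximal and right-maximal substrings of $T$ and $\mathsf{M}(T)=\mathsf{LeftM}(T)\cap\mathsf{RightM}(T)$. For a string $x$, let $\mathsf{D}_T(x)=|\{a\in\Sigma : xa\in\mathrm{Substr}(T)\}|$.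 The size of the compact directed acyclic word graph (CDAWG) of $T$ is $\mathsf{size}(T)=\sum_{x\in\mathsf{M}(T)}\mathsf{D}_T(x)$ (its number of edges). With $\mathcal{K}(T,1)=\{S:\mathrm{ed}(S,T)=1\}$, the sensitivities are $\mathrm{MS}_{\mathrm{ins}}(\mathsf{size},n)=\max_{T\in\Sigma^n,\,T'\in\mathcal{K}(T,1)\cap\Sigma^{n+1}}\mathsf{size}(T')/\mathsf{size}(T)$, and analogously $\mathrm{MS}_{\mathrm{del}}$ with $\Sigma^{n-1}$ and $\mathrm{MS}_{\mathrm{sub}}$ with $\Sigma^{n}$. *)

(* Defs.v *)
From mathcomp Require Import all_boot all_order all_algebra.
Set Implicit Arguments. Unset Strict Implicit. Unset Printing Implicit Defensive.

Section Strings.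
Variable Sigma : finType.
Implicit Types (T w x : seq Sigma).

(* Substr / Prefix / Suffix membership (all include the empty string) are
   seq's [infix], [prefix], [suffix]. *)

Definition left_maximal T w : bool :=
  infix w T &&
  (prefix w T ||
   [exists a : Sigma, exists b : Sigma,
      [&& a != b, infix (a :: w) T & infix (b :: w) T]]).

Definition right_maximal T w : bool :=
  infix w T &&
  (suffix w T ||
   [exists a : Sigma, exists b : Sigma,
      [&& a != b, infix (rcons w a) T & infix (rcons w b) T]]).

Definition maximal T w : bool := left_maximal T w && right_maximal T w.

Definition D T x : nat := #|[set a : Sigma | infix (rcons x a) T]|.

Definition substrs T : seq (seq Sigma) :=
  undup [seq drop i (take j T) | j <- iota 0 (size T).+1, i <- iota 0 (size T).+1].

(* size(T) = sum_{x in M(T)} D_T(x): number of edges of the CDAWG *)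
Definition cdawg_size T : nat :=
  \sum_(x <- substrs T | maximal T x) D T x.

Definition ed1 T T' : Prop :=
  exists (u v : seq Sigma) (a b : Sigma),
    (T = u ++ v /\ T' = u ++ a :: v) \/
    (T = u ++ a :: v /\ T' = u ++ v) \/
    (T = u ++ a :: v /\ T' = u ++ b :: v /\ a <> b).

End Strings.

(* Main.v *)
Require Import Defs.
From mathcomp Require Import all_boot all_order all_algebra zify.
Import Order.TTheory GRing.Theory Num.Theory.
Set Implicit Arguments. Unset Strict Implicit. Unset Printing Implicit Defensive.

(* Write T = u c v and T' = u b v with |b| <= 1.  Scan T' from left to right: at each
   position only one string can acquire a left extension not seen before, namely the
   longest suffix of the scanned prefix u b q that occurs in T or earlier in T'.  So
   each maximal x of T' that is not left-maximal in T is determined by a prefix q of v,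
   and q is a suffix of x, hence has at least as many right extensions.  Symmetrically,
   each new right extension of x is determined by a suffix r of u that is a prefix of x.
   The strings q and r occur in T; extending them by the context common to all their
   occurrences gives maximal substrings of T, and this is injective on right-maximal
   prefixes of v, on left-maximal suffixes of u, and on strings that are both prefixes
   of v and suffixes of u.  With s = size(T) and |M(T)| <= s + 1, the edges of T' out
   of right-maximal strings of T that are already present in T number at most 2 s.
   The suffixes r number at most 2 |M(T)| and bound both the new edges and the new
   right-maximal strings, each of which has at most one further edge.  The total is
   2 s + 4 (s + 1) = 6 s + 4. *)

(** No [j] is related to two members of [r], so distinct [i] have distinct witnesses and each [j]
    can be removed from [s] once used. A relation stands in for an injection because later witnesses
    are known only by existence. *)
Lemma leq_sum_relation (I J : eqType) (R : I -> J -> Prop) (F : I -> nat)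
    (G : J -> nat) (r : seq I) (s : seq J) :
    uniq r ->
    (forall i, i \in r -> exists2 j, j \in s & R i j /\ F i <= G j) ->
    (forall i i' j, i \in r -> i' \in r -> R i j -> R i' j -> i = i') ->
  \sum_(i <- r) F i <= \sum_(j <- s) G j.
Proof.
elim: r s => [|i r IHr] s; first by rewrite big_nil.
move=> /= /andP[i_notin r_uniq] ex_j inj_R; rewrite big_cons.
have [j s_j [Rij leFG]] := ex_j i (mem_head _ _).
rewrite (perm_big _ (perm_to_rem s_j)) big_cons leq_add //.
apply: IHr => // [i' r_i' | i1 i2 j' r1 r2].
  have [j' s_j' [Rij' leFG']] := ex_j i' (mem_behead (s := i :: r) r_i').
  exists j' => //; have neq_j : j' != j.
    apply: contraNneq i_notin => eq_j; rewrite eq_j in Rij'.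
    by rewrite (inj_R i i' j) ?mem_head // inE r_i' orbT.
  by move: s_j'; rewrite (perm_mem (perm_to_rem s_j)) inE (negPf neq_j).
by apply: inj_R; rewrite inE ?r1 ?r2 orbT.
Qed.

Section Strings.
Variable Sigma : finType.
Implicit Types (T u b v w x y q r s t : seq Sigma) (a c : Sigma).

(** * Comparing factorizations of one word *)

Lemma eq_cat_le s1 t1 s2 t2 :
  s1 ++ t1 = s2 ++ t2 -> size s1 <= size s2 ->
  exists w, s2 = s1 ++ w /\ t1 = w ++ t2.
Proof.
move=> eq_st le_s; exists (drop (size s1) s2).
have eq_s1 : take (size s1) s2 = s1.
  have := congr1 (take (size s1)) eq_st.
  by rewrite take_size_cat // takel_cat.
have eq_s2 : s2 = s1 ++ drop (size s1) s2 by rewrite -{1}eq_s1 cat_take_drop.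
split=> //; move: eq_st; rewrite {1}eq_s2 -catA => /eqP.
by rewrite eqseq_cat // eqxx => /eqP.
Qed.

Lemma eq_cat_le_r s1 t1 s2 t2 :
  s1 ++ t1 = s2 ++ t2 -> size t2 <= size t1 ->
  exists w, s2 = s1 ++ w /\ t1 = w ++ t2.
Proof.
move=> eq_st le_t; apply: eq_cat_le (eq_st) _.
by have := congr1 size eq_st; rewrite !size_cat; lia.
Qed.

Lemma suffix_size_inj s1 s2 t :
  suffix s1 t -> suffix s2 t -> size s1 = size s2 -> s1 = s2.
Proof.
by rewrite !suffixE => /eqP def1 /eqP def2 eq_s; rewrite -def1 -def2 eq_s.
Qed.

Lemma suffix_le s1 s2 t :
  suffix s1 t -> suffix s2 t -> size s1 <= size s2 -> suffix s1 s2.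
Proof.
move=> /suffixP[z1 ->] /suffixP[z2 eq_t] le_s.
have [w [_ ->]] := eq_cat_le_r (esym eq_t) le_s.
exact: suffix_suffix.
Qed.

Lemma prefix_le s1 s2 t :
  prefix s1 t -> prefix s2 t -> size s1 <= size s2 -> prefix s1 s2.
Proof. by rewrite -!suffix_rev -(size_rev s1) -(size_rev s2); apply: suffix_le. Qed.

Lemma leftmost_occurrence w T :
  infix w T ->
  exists s t, T = s ++ w ++ t /\
    forall s' t', T = s' ++ w ++ t' -> size s <= size s'.
Proof.
move=> w_T; have ex_n : exists n, (n <= size T) && prefix w (drop n T).
  have /infixP[s [t ->]] := w_T; exists (size s).
  by rewrite size_cat leq_addr drop_size_cat // prefix_prefix.
case: (ex_minnP ex_n) => n /andP[le_n /prefixP[t eq_t]] min_n.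
exists (take n T), t; split; first by rewrite -eq_t cat_take_drop.
move=> s' t' eq_T; rewrite size_takel //; apply: min_n.
by rewrite {2}eq_T drop_size_cat // prefix_prefix eq_T size_cat leq_addr.
Qed.

(** * Maximal substrings: reversal, heredity, number *)

Lemma left_maximal_rev T x : left_maximal (rev T) (rev x) = right_maximal T x.
Proof.
rewrite /left_maximal /right_maximal infix_rev prefix_rev; congr (_ && (_ || _)).
by apply: eq_existsb => a; apply: eq_existsb => c; rewrite -!rev_rcons !infix_rev.
Qed.

Lemma right_maximal_rev T x : right_maximal (rev T) (rev x) = left_maximal T x.
Proof. by rewrite -left_maximal_rev !revK. Qed.

Lemma mem_substrs T x : (x \in substrs T) = infix x T.
Proof.
rewrite mem_undup; apply/allpairsP/infixP => [[[j i] /= [_ _ ->]] | [s [t ->]]].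
  exists (take i (take j T)), (drop j T).
  by rewrite catA !cat_take_drop.
exists (size (s ++ x), size s); rewrite !mem_iota catA.
by split; rewrite /= ?take_size_cat ?drop_size_cat // !size_cat; lia.
Qed.

Lemma uniq_substrs T : uniq (substrs T).
Proof. exact: undup_uniq. Qed.

Lemma left_maximal_prefix T x y :
  left_maximal T x -> prefix y x -> left_maximal T y.
Proof.
case/andP=> x_T left_x y_x; rewrite /left_maximal (prefix_infix_trans y_x) //=.
case/orP: left_x => [x_pT | /existsP[a /existsP[c /and3P[neq_ac ax_T cx_T]]]].
  by rewrite (prefix_trans y_x).
apply/orP; right; apply/existsP; exists a; apply/existsP; exists c.
by rewrite neq_ac (prefix_infix_trans _ ax_T) ?(prefix_infix_trans _ cx_T)
  // prefix_cons eqxx.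
Qed.

Lemma right_maximal_suffix T x y :
  right_maximal T x -> suffix y x -> right_maximal T y.
Proof.
by rewrite -!left_maximal_rev -prefix_rev; apply: left_maximal_prefix.
Qed.

(** Nothing follows [x], so it occurs only at the end of [T]. Two distinct characters cannot precede
    that single occurrence, hence [x] is also a prefix. *)
Lemma maximal_D0 T x : maximal T x -> D T x = 0 -> x = T.
Proof.
case/andP=> left_x _ /eqP; rewrite cards_eq0 => /eqP/setP D0.
have end_x s t : T = s ++ x ++ t -> t = [::].
  case: t => // a t eq_T; have := D0 a; rewrite !inE => /negP[].
  by apply/infixP; exists s, t; rewrite cat_rcons.
case/andP: left_x => _ /orP[/prefixP[t eq_T] |].
  by rewrite eq_T (end_x [::] t eq_T) cats0.
case/existsP=> a /existsP[c /and3P[/eqP neq_ac]].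
case/infixP=> s [t eq_T] /infixP[s' [t' eq_T']]; case: neq_ac.
have t0 : t = [::] by apply: (end_x (rcons s a)); rewrite eq_T cat_rcons.
have t0' : t' = [::] by apply: (end_x (rcons s' c)); rewrite eq_T' cat_rcons.
have: suffix (a :: x) T by rewrite eq_T t0 cats0 suffix_suffix.
have: suffix (c :: x) T by rewrite eq_T' t0' cats0 suffix_suffix.
by move=> c_T a_T; have [] := suffix_size_inj a_T c_T erefl.
Qed.

Definition maximals T := [seq x <- substrs T | maximal T x].

Lemma uniq_maximals T : uniq (maximals T).
Proof. by rewrite filter_uniq // uniq_substrs. Qed.

Lemma mem_maximals T x : (x \in maximals T) = maximal T x.
Proof.
rewrite mem_filter mem_substrs andb_idr // => /andP[/andP[]] //.
Qed.

(** By [maximal_D0] every maximal substring other than [T] has an outgoing edge; the extra 1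
    accounts for [T], the sink of the CDAWG. *)
Lemma size_maximals T : size (maximals T) <= cdawg_size T + 1.
Proof.
rewrite /cdawg_size -big_filter -/(maximals T) -sum1_size.
apply: (@leq_trans (\sum_(x <- maximals T) (D T x + (x == T)))).
  rewrite !big_seq; apply: leq_sum => x; rewrite mem_maximals => max_x.
  by case Dx: (D T x) => [|d] //; rewrite (maximal_D0 max_x Dx) eqxx.
rewrite big_split leq_add2l /=.
by rewrite -[X in X <= _](big_mkcond (pred1 T) (fun _ => 1)) sum1_count
  count_uniq_mem ?uniq_maximals // leq_b1.
Qed.

(** * Closure of a substring under its forced context *)

Definition surrounded T x l r : Prop :=
  forall s t, T = s ++ x ++ t -> suffix l s /\ prefix r t.

(** For [x] occurring in [T] and [y] maximal, [y] is the CDAWG node that represents [x]. *)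
Definition closure_of T x y : Prop :=
  exists l r, y = l ++ x ++ r /\ surrounded T x l r.

Lemma surrounded_rev T x l r :
  surrounded T x l r -> surrounded (rev T) (rev x) (rev r) (rev l).
Proof.
move=> ext_x s t eq_T; have [|l_t r_s] := ext_x (rev t) (rev s).
  by rewrite -(revK T) eq_T !rev_cat revK catA.
by rewrite suffix_revLR prefix_revLR.
Qed.

Lemma closure_of_cons T a x y :
    (forall s t, T = s ++ x ++ t -> suffix [:: a] s) ->
  closure_of T (a :: x) y -> closure_of T x y.
Proof.
move=> ext_x [l [r [-> ext_ax]]]; exists (rcons l a), r.
rewrite cat_rcons; split=> // s t eq_T.
have /suffixP[s' eq_s] := ext_x s t eq_T.
have [|/suffixP[s'' eq_s'] r_t] := ext_ax s' t.
  by rewrite eq_T eq_s -catA.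
by split=> //; rewrite eq_s eq_s' -cats1 suffix_catl // eqxx suffix_suffix.
Qed.

Lemma closure_of_rev T x y : closure_of (rev T) (rev x) (rev y) -> closure_of T x y.
Proof.
case=> l [r [eq_y ext_x]]; exists (rev r), (rev l); split.
  by rewrite -(revK y) eq_y !rev_cat revK catA.
by rewrite -(revK T) -(revK x); apply: surrounded_rev.
Qed.

Lemma not_left_maximal T x :
  infix x T -> ~~ left_maximal T x ->
  exists2 a, infix (a :: x) T & forall s t, T = s ++ x ++ t -> suffix [:: a] s.
Proof.
move=> x_T; rewrite /left_maximal x_T /= negb_or => /andP[x_npre x_nleft].
have occ_cons s t : T = s ++ x ++ t -> exists a s', s = rcons s' a.
  case/lastP: s => [eq_T | s a _]; last by exists a, s.
  by case/negP: x_npre; rewrite eq_T prefix_prefix.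
have /infixP[s [t eq_T]] := x_T; have [a [s' eq_s]] := occ_cons s t eq_T.
have ax_T : infix (a :: x) T.
  by apply/infixP; exists s', t; rewrite eq_T eq_s cat_rcons.
exists a => // s1 t1 eq_T1; have [c [s1' eq_s1]] := occ_cons s1 t1 eq_T1.
suff -> : a = c by rewrite eq_s1 -cats1 suffix_suffix.
apply: contraNeq x_nleft => neq_ac; apply/existsP; exists a; apply/existsP; exists c.
rewrite neq_ac ax_T; apply/infixP; exists s1', t1.
by rewrite eq_T1 eq_s1 cat_rcons.
Qed.

(** While one side fails to be maximal, a forced character can be added there; the longer word still
    occurs in [T], so the process stops. *)
Lemma closure_exists T x :
  infix x T -> exists2 y, maximal T y & closure_of T x y.
Proof.
have [n] := ubnP (size T - size x); elim: n T x => // n IHn T x lt_n x_T.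
(* Stated for any word, so that on [rev T] it extends [x] to the right. *)
have step T1 z : size T1 - size z < n.+1 -> infix z T1 -> ~~ left_maximal T1 z ->
    exists2 y, maximal T1 y & closure_of T1 z y.
  move=> lt1 z_T z_nleft; have [a az_T ext_z] := not_left_maximal z_T z_nleft.
  have := size_infix az_T; rewrite /= => le_az.
  have [|y max_y clo_y] := IHn T1 (a :: z) _ az_T; first by move: lt1 le_az => /=; lia.
  by exists y => //; apply: closure_of_cons clo_y.
have [left_x | x_nleft] := boolP (left_maximal T x); last exact: step.
have [right_x | x_nright] := boolP (right_maximal T x).
  exists x; first exact/andP.
  by exists [::], [::]; rewrite cats0; split=> // s t _; rewrite suffix0s prefix0s.
have [|||y max_y clo_y] := step (rev T) (rev x).
- by rewrite !size_rev.
- by rewrite infix_rev.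
- by rewrite left_maximal_rev.
exists (rev y); last by apply: closure_of_rev; rewrite revK.
by rewrite /maximal andbC -(left_maximal_rev T) -(right_maximal_rev T) revK.
Qed.

Lemma D_rev T x : D T x = #|[set a | infix (a :: rev x) (rev T)]|.
Proof. by apply: eq_card => a; rewrite !inE -rev_rcons infix_rev. Qed.

(** Two distinct continuations, or an occurrence ending [T], share no nonempty right context. *)
Lemma closure_right_nil T x l r :
  right_maximal T x -> surrounded T x l r -> r = [::].
Proof.
move=> /andP[x_T right_x] ext_x.
case/orP: right_x => [/suffixP[s eq_T] |].
  have [|_] := ext_x s [::]; first by rewrite cats0.
  by rewrite prefixs0 => /eqP.
case/existsP=> a /existsP[c /and3P[/eqP neq_ac]].
case/infixP=> s [t]; rewrite cat_rcons => /ext_x[_ pre_a].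
case/infixP=> s' [t']; rewrite cat_rcons => /ext_x[_].
case: r pre_a {ext_x} => //= e r /andP[/eqP eq_ea _] /andP[/eqP eq_ec _].
by case: neq_ac; rewrite -eq_ea.
Qed.

(** The closure of a right-maximal [x] grows only to the left, so whatever follows [x] also follows
    [y]. *)
Lemma closure_D T x y : right_maximal T x -> closure_of T x y -> D T x <= D T y.
Proof.
move=> right_x [l [r [-> ext_x]]].
rewrite (closure_right_nil right_x ext_x) cats0; apply/subset_leq_card/subsetP => a; rewrite !inE.
case/infixP=> s [t]; rewrite cat_rcons => eq_T; have [/suffixP[s' eq_s] _] := ext_x _ _ eq_T.
by apply/infixP; exists s', t; rewrite eq_T eq_s cat_rcons -!catA.
Qed.



(* Otherwise the copy of [l1 ++ x1 ++ r1] around the [x1] that starts the leftmost [x2] would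
   contain an [x2] further to the left. *)
Lemma closure_prefix_le T x1 x2 l1 r1 l2 r2 :
    surrounded T x1 l1 r1 ->
    l1 ++ x1 ++ r1 = l2 ++ x2 ++ r2 ->
    infix x2 T -> prefix x1 x2 ->
  size l1 <= size l2.
Proof.
move=> ext1 eq_y x2_T /prefixP[w eq_x2].
have [s [t [eq_T min_s]]] := leftmost_occurrence x2_T.
have [|/suffixP[s' eq_s] /prefixP[t' eq_t]] := ext1 s (w ++ t).
  by rewrite eq_T eq_x2 -!catA.
have := min_s (s' ++ l2) (r2 ++ t').
rewrite eq_s !size_cat leq_add2l; apply.
have -> : T = s' ++ (l1 ++ x1 ++ r1) ++ t' by rewrite eq_T eq_s eq_x2 -!catA eq_t.
by rewrite eq_y -!catA.
Qed.

Lemma closure_suffix_le T x1 x2 l1 r1 l2 r2 :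
    surrounded T x1 l1 r1 ->
    l1 ++ x1 ++ r1 = l2 ++ x2 ++ r2 ->
    infix x2 T -> suffix x1 x2 ->
  size r1 <= size r2.
Proof.
move=> /surrounded_rev ext1 eq_y x2_T x1_x2; rewrite -(size_rev r1) -(size_rev r2).
apply: (closure_prefix_le (x2 := rev x2) (r2 := rev l2) ext1).
- by have := congr1 rev eq_y; rewrite !rev_cat !catA.
- by rewrite infix_rev.
- by rewrite prefix_rev.
Qed.

Lemma closure_left_nil T x l r :
  left_maximal T x -> surrounded T x l r -> l = [::].
Proof.
rewrite -right_maximal_rev => right_x /surrounded_rev.
by move=> /(closure_right_nil right_x)/(congr1 rev); rewrite revK.
Qed.

(** Both closures grow only to the left. The shorter [q] has the left context that is not longer, by
    [closure_prefix_le], and the total lengths agree, so the sizes are equal. *)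
Lemma closure_inj_prefix T v y q1 q2 :
    infix v T -> prefix q1 v -> prefix q2 v ->
    right_maximal T q1 -> right_maximal T q2 ->
    closure_of T q1 y -> closure_of T q2 y ->
  q1 = q2.
Proof.
move=> v_T; wlog le_q : q1 q2 / size q1 <= size q2 => [IH | q1_v q2_v].
  by case/orP: (leq_total (size q1) (size q2)) => le_q *; [|symmetry]; apply: IH.
move=> right1 right2 [l1 [r1 [-> ext1]]] [l2 [r2 [eq_y ext2]]].
have q1_q2 := prefix_le q1_v q2_v le_q.
have := closure_prefix_le ext1 eq_y (prefix_infix_trans q2_v v_T) q1_q2.
have := congr1 size eq_y; rewrite !size_cat.
rewrite (closure_right_nil right1 ext1) (closure_right_nil right2 ext2) => eq_size le_l.
apply: (inv_inj revK); apply: (suffix_size_inj (t := rev v)); rewrite ?suffix_rev //.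
by rewrite !size_rev; move: eq_size le_l le_q => /=; lia.
Qed.

Lemma closure_inj_suffix T u y r1 r2 :
    infix u T -> suffix r1 u -> suffix r2 u ->
    left_maximal T r1 -> left_maximal T r2 ->
    closure_of T r1 y -> closure_of T r2 y ->
  r1 = r2.
Proof.
rewrite -infix_rev -!prefix_rev -!right_maximal_rev => u_T r1_u r2_u max1 max2 clo1 clo2.
apply: (inv_inj revK); apply: (closure_inj_prefix (y := rev y)) u_T _ _ max1 max2 _ _ => //.
  by apply: closure_of_rev; rewrite !revK.
by apply: closure_of_rev; rewrite !revK.
Qed.

(** The shorter word is both a prefix and a suffix of the longer, so neither of its contexts is
    longer than the corresponding one; equal total length forces equal sizes. *)
Lemma closure_inj_border T u v y q1 q2 :
    infix v T -> prefix q1 v -> prefix q2 v -> suffix q1 u -> suffix q2 u ->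
    closure_of T q1 y -> closure_of T q2 y ->
  q1 = q2.
Proof.
move=> v_T; wlog le_q : q1 q2 / size q1 <= size q2 => [IH | q1_v q2_v q1_u q2_u].
  by case/orP: (leq_total (size q1) (size q2)) => le_q *; [|symmetry]; apply: IH.
move=> [l1 [r1 [-> ext1]]] [l2 [r2 [eq_y _]]].
have q2_T := prefix_infix_trans q2_v v_T.
have := closure_prefix_le ext1 eq_y q2_T (prefix_le q1_v q2_v le_q).
have := closure_suffix_le ext1 eq_y q2_T (suffix_le q1_u q2_u le_q).
have := congr1 size eq_y; rewrite !size_cat => eq_size le_r le_l.
by apply: suffix_size_inj q1_u q2_u _; move: eq_size le_r le_l le_q => /=; lia.
Qed.

(** * Scanning a word from left to right *)

Definition prefixes v := [seq take k v | k <- iota 0 (size v).+1].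

Lemma mem_prefixes v q : (q \in prefixes v) = prefix q v.
Proof.
apply/mapP/idP => [[k _ ->] | q_v]; first exact: prefix_take.
exists (size q); first by rewrite mem_iota add0n ltnS size_prefix.
by apply/esym/eqP; rewrite -prefixE.
Qed.

Lemma uniq_prefixes v : uniq (prefixes v).
Proof.
rewrite map_inj_in_uniq ?iota_uniq // => k l; rewrite !mem_iota !add0n !ltnS /=.
by move=> le_k le_l /(congr1 size); rewrite !size_takel.
Qed.

(** Dropping the last character of [P] discards the occurrences that end where [P] ends. *)
Definition known T P w := infix w T || infix w (take (size P).-1 P).

(* [x] is the longest suffix of [P := u ++ b ++ q] occurring in [T] or ending
   properly inside [P]; scanning [u ++ b ++ v] from left to right, this is the only
   string that can gain a left extension at the end of [P]. *)
Definition branching T u b q x :=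
  let P := u ++ b ++ q in
  [&& suffix x P, suffix q x, known T P x &
      [forall a, suffix (a :: x) P ==> ~~ known T P (a :: x)]].

Lemma known_infix T P x y : infix x y -> known T P y -> known T P x.
Proof.
by move=> x_y /orP[] y_in; rewrite /known (infix_trans x_y y_in) ?orbT.
Qed.

(** If [x1] were shorter, the suffix [a :: x1] of [x2] would be known along with [x2], against the
    choice of [x1] as longest. *)
Lemma branching_inj T u b q x1 x2 :
  branching T u b q x1 -> branching T u b q x2 -> x1 = x2.
Proof.
wlog le_x : x1 x2 / size x1 <= size x2 => [IH | ].
  by case/orP: (leq_total (size x1) (size x2)) => le_x *; [|symmetry]; apply: IH.
case/and4P=> x1_P _ _ /forallP longest /and4P[x2_P _ known2 _].
have /suffixP[s eq_x2] := suffix_le x1_P x2_P le_x.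
case/lastP: s eq_x2 => [-> // | s a]; rewrite cat_rcons => eq_x2.
have ax_x2 : suffix (a :: x1) x2 by rewrite eq_x2 suffix_suffix.
have /implyP/(_ (suffix_trans ax_x2 x2_P)) := longest a.
by rewrite (known_infix (suffixW ax_x2)).
Qed.

(** * Left extensions created by the edit *)

Section Edit.
Variables u b v T : seq Sigma.
Hypotheses (u_T : prefix u T) (v_T : suffix v T) (size_b : size b <= 1).
Let T' := u ++ b ++ v.

(** The leftmost occurrence of [a :: x] in [T'] lies neither within [u] nor within [v], since both
    occur in [T]. As [b] has at most one character, it ends at or after the end of [b]; [q] is the
    part of [v] it covers. *)
Lemma new_left_extension a x :
    infix (a :: x) T' -> ~~ infix (a :: x) T ->
  exists2 q, q \in prefixes v &
    let P := u ++ b ++ q in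
    [/\ suffix (a :: x) P, suffix q x & ~~ infix (a :: x) (take (size P).-1 P)].
Proof.
move=> /leftmost_occurrence[s [t [eq_T' min_s]]] ax_nT.
have size_u : size u < size (s ++ a :: x).
  rewrite ltnNge; apply: contra ax_nT => le_u.
  have [|w [eq_u _]] := @eq_cat_le (s ++ a :: x) t u (b ++ v) _ le_u.
    by rewrite -catA -eq_T'.
  apply: infix_prefix_trans u_T; rewrite eq_u -catA; exact: infix_infix.
have [||q [eq_P eq_v]] := @eq_cat_le (u ++ b) v (s ++ a :: x) t.
- by rewrite -!catA -eq_T'.
- by move: size_u size_b; rewrite !size_cat /=; lia.
have size_s : size s < size (u ++ b).
  rewrite ltnNge; apply: contra ax_nT => le_s.
  have [|w [_ eq_v']] := @eq_cat_le (u ++ b) v s ((a :: x) ++ t) _ le_s.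
    by rewrite -catA -eq_T'.
  apply: infix_suffix_trans v_T; rewrite eq_v'; exact: infix_infix.
have [||w [_ eq_x]] := @eq_cat_le_r (rcons s a) x (u ++ b) q.
- by rewrite cat_rcons eq_P.
- by have := congr1 size eq_P; move: size_s; rewrite !size_cat /=; lia.
exists q; first by rewrite mem_prefixes eq_v prefix_prefix.
rewrite catA -eq_P; split; first exact: suffix_suffix.
  by rewrite eq_x suffix_suffix.
apply/negP=> /infixP[s' [t' eq_take]].
set P := s ++ a :: x in eq_take; set k := (size P).-1 in eq_take.
have := min_s s' (t' ++ drop k P ++ t).
have -> : s' ++ (a :: x) ++ t' ++ drop k P ++ t = T'.
  by rewrite eq_T' catA -/P -[in RHS](cat_take_drop k P) eq_take -!catA.
move/(_ erefl); have := congr1 size eq_take; rewrite size_takel ?leq_pred //.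
by rewrite /k /P !size_cat /=; lia.
Qed.

Lemma branchingI a x q :
    let P := u ++ b ++ q in
    suffix (a :: x) P -> suffix q x -> ~~ infix (a :: x) T ->
    ~~ infix (a :: x) (take (size P).-1 P) -> known T P x ->
  branching T u b q x.
Proof.
move=> P ax_P q_x ax_nT ax_nP known_x; apply/and4P; split=> //.
  exact: suffix_trans (suffix_cons x a) ax_P.
apply/forallP=> c; apply/implyP=> cx_P.
by rewrite (suffix_size_inj cx_P ax_P) // negb_or ax_nT.
Qed.

Lemma infix_take_prefix P Q x :
  prefix P Q -> size P < size Q -> infix x P -> infix x (take (size Q).-1 Q).
Proof.
move=> P_Q lt_P x_P; apply: (infix_prefix_trans x_P).
apply: (prefix_le P_Q (prefix_take _ _)).
by rewrite size_takel ?leq_pred // -ltnS (ltn_predK lt_P).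
Qed.

(** An extension absent from [T] is charged to the prefix [q] where it first appears, if [x] was
    already known there. When [x] occurs in [T] this always holds, and the uncharged extensions are
    among those in [T]. Otherwise they come with the first appearance of [x], so there is at most
    one. *)
Lemma left_degree_le x :
  #|[set a | infix (a :: x) T']| <=
    (if left_maximal T x then #|[set a | infix (a :: x) T]| else 1)
    + count (fun q => branching T u b q x) (prefixes v).
Proof.
set A := [set a | _]; set B := [set a | infix _ T].
pose good a q := branching T u b q x && suffix (a :: x) (u ++ b ++ q).
pose G := [set a in A | has (good a) (prefixes v)].
have card_G : #|G| <= count (fun q => branching T u b q x) (prefixes v).
  rewrite cardE -size_filter -!sum1_size.
  apply: (leq_sum_relation (R := fun a q => good a q)); first exact: enum_uniq.
    move=> a; rewrite mem_enum inE => /andP[_ /hasP[q q_v good_q]].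
    by exists q => //; rewrite mem_filter q_v andbT; case/andP: good_q.
  move=> a c q _ _ /andP[_ ax] /andP[_ cx].
  by have [] := suffix_size_inj ax cx erefl.
have bad_new a : a \in A :\: G -> a \notin B -> exists2 q, q \in prefixes v &
    suffix (a :: x) (u ++ b ++ q) /\ ~~ known T (u ++ b ++ q) x.
  rewrite !inE => /andP[a_nG a_A] a_nB; rewrite a_A andTb in a_nG.
  have [q q_v [ax_P q_x ax_nP]] := new_left_extension a_A a_nB.
  exists q => //; split=> //; apply: contra a_nG => known_x.
  by apply/hasP; exists q => //; rewrite /good ax_P (branchingI ax_P).
rewrite -(cardsID G A) addnC leq_add //; last first.
  by apply: leq_trans card_G; rewrite subset_leq_card // subsetIr.
have [x_T | x_nT] := boolP (infix x T).
  have sub_B : A :\: G \subset B.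
    apply/subsetP=> a a_AG; apply: contraLR isT => a_nB.
    by have [q _ [_]] := bad_new a a_AG a_nB; rewrite /known x_T.
  apply: leq_trans (subset_leq_card sub_B) _; case: ifPn => // x_nleft.
  have [a _ ext_x] := not_left_maximal x_T x_nleft.
  apply: leq_trans (_ : #|[set a]| <= 1); last by rewrite cards1.
  apply/subset_leq_card/subsetP => c; rewrite !inE => /infixP[s [t eq_T]].
  have := ext_x (rcons s c) t; rewrite cat_rcons => /(_ eq_T).
  by rewrite -cats1 -[X in suffix X]cat0s suffix_catl // eqseq_cons eqxx andbT
     => /andP[/eqP->].
rewrite [left_maximal T x]/left_maximal (negPf x_nT) /=.
rewrite leqNgt; apply/negP => /card_gt1P[a [c [a_AG c_AG neq_ac]]].
have nB e : e \notin B.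
  by rewrite inE; apply: contra x_nT => /consl_infix.
have [q1 q1_v [ax_P1 x_nP1]] := bad_new a a_AG (nB a).
have [q2 q2_v [cx_P2 x_nP2]] := bad_new c c_AG (nB c).
(* Equal [q] would give equal characters; with [q1] shorter, the occurrence ending at [q1] makes [x]
   known at [q2]. *)
wlog lt_q : a c q1 q2 neq_ac {a_AG c_AG} q1_v q2_v ax_P1 cx_P2 x_nP1 x_nP2
    / size q1 < size q2 => [IH|].
  case: (ltngtP (size q1) (size q2)) => [lt_q | lt_q | eq_q].
  - exact: (IH a c q1 q2).
  - by apply: (IH c a q2 q1) => //; rewrite eq_sym.
  have eq_q12 : q1 = q2.
    by move: q1_v q2_v; rewrite !mem_prefixes !prefixE eq_q => /eqP<- /eqP.
  rewrite eq_q12 in ax_P1; have [eq_ac] := suffix_size_inj ax_P1 cx_P2 erefl.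
  by rewrite eq_ac eqxx in neq_ac.
case/norP: x_nP2 => _ /negP[].
apply: (@infix_take_prefix (u ++ b ++ q1)).
- rewrite !prefix_catr // !eqxx /=.
  by apply: (prefix_le (t := v)); rewrite -?mem_prefixes // ltnW.
- by rewrite !size_cat; move: lt_q; lia.
exact: consl_infix (suffixW ax_P1).
Qed.

(** Two left extensions exceed the 1 allowed by [left_degree_le]. Otherwise [x] is a prefix of [T'];
    if it is absent from [T], the last hypothesis yields a second occurrence, whose left extension
    is new. *)
Lemma left_maximal_branching x :
    left_maximal T' x -> ~~ left_maximal T x ->
    (infix x T \/ right_maximal T' x /\ x != T') ->
  has (fun q => branching T u b q x) (prefixes v).
Proof.
move=> /andP[x_T' left_x] x_nleft cases_x.
case/orP: left_x => [x_pre | /existsP[a /existsP[c /and3P[neq_ac ax cx]]]]; last first.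
  rewrite has_count -(ltn_add2l 1) addn0.
  apply: leq_trans (_ : #|[set a | infix (a :: x) T']| <= _).
    by apply/card_gt1P; exists a, c; rewrite !inE.
  by have := left_degree_le x; rewrite (negPf x_nleft).
have [x_T | x_nT] := boolP (infix x T).
  (* A prefix of [u] would be left-maximal in [T]. So [x] is a whole scanned prefix [u ++ b ++ q],
     with no room for a left extension inside it. *)
  have lt_u : size u < size x.
    rewrite ltnNge; apply: contra x_nleft => le_x; rewrite /left_maximal x_T /=.
    by rewrite (prefix_trans (prefix_le x_pre (prefix_prefix _ _) le_x) u_T).
  have [t eq_T'] := prefixP x_pre.
  have [||q [eq_x eq_v]] := @eq_cat_le (u ++ b) v x t.
  - by rewrite -catA.
  - by move: lt_u size_b; rewrite size_cat; lia.
  apply/hasP; exists q; first by rewrite mem_prefixes eq_v prefix_prefix.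
  rewrite -catA in eq_x; apply/and4P; split.
  - by rewrite eq_x suffix_refl.
  - by rewrite eq_x catA suffix_suffix.
  - by rewrite /known x_T.
  apply/forallP=> a; apply/implyP=> /size_suffix.
  by rewrite -eq_x /= ltnn.
have [a ax_T'] : exists a, infix (a :: x) T'.
  have occ s t : T' = s ++ x ++ t -> s != [::] -> exists a, infix (a :: x) T'.
    case/lastP: s => // s a eq_T' _; exists a; apply/infixP; exists s, t.
    by rewrite eq_T' cat_rcons.
  case: cases_x => [|[/andP[_ right_x] x_neq]]; first by rewrite (negPf x_nT).
  case/orP: right_x => [/suffixP[s eq_T'] |].
    apply: (occ s [::]); rewrite ?cats0 //; apply: contra_neq x_neq => s0.
    by rewrite eq_T' s0.
  case/existsP=> a /existsP[c /and3P[neq_ac]].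
  case/infixP=> s [t eq1] /infixP[s' [t' eq2]].
  rewrite cat_rcons in eq1; rewrite cat_rcons in eq2.
  have [s0 | s_neq] := eqVneq s [::]; last exact: occ eq1 s_neq.
  apply: (occ _ _ eq2); apply: contra_neq neq_ac => s0'.
  by move: eq1; rewrite eq2 s0 s0' !cat0s => /eqP; rewrite eqseq_cat // eqxx andTb eqseq_cons => /andP[/eqP-> _].
have [|q q_v [ax_P q_x ax_nP]] := new_left_extension ax_T' _.
  by apply: contra x_nT => /consl_infix.
apply/hasP; exists q => //; apply: (branchingI ax_P) => //.
  by apply: contra x_nT => /consl_infix.
(* [x] also starts [T'], and this earlier occurrence makes it known at [q]. *)
apply/orP; right; apply: (@infix_take_prefix x); rewrite ?infix_refl //.
  apply: (prefix_le x_pre (t := T')).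
    rewrite /T' !prefix_catr // !eqxx /=; by rewrite -mem_prefixes.
  by have := size_suffix ax_P => /=; lia.
exact: size_suffix ax_P.
Qed.
End Edit.

(** * Counting the edges after the edit *)

Section EditBound.
Variables u b c v : seq Sigma.
Hypothesis size_b : size b <= 1.
Let T := u ++ c ++ v.
Let T' := u ++ b ++ v.

Let u_T : prefix u T. Proof. exact: prefix_prefix. Qed.
Let v_T : suffix v T. Proof. by rewrite /T catA suffix_suffix. Qed.
Let rev_T' : rev v ++ rev b ++ rev u = rev T'.
Proof. by rewrite /T' !rev_cat catA. Qed.
Let rv_T : prefix (rev v) (rev T). Proof. by rewrite prefix_rev. Qed.
Let ru_T : suffix (rev u) (rev T). Proof. by rewrite suffix_rev. Qed.
Let size_rb : size (rev b) <= 1. Proof. by rewrite size_rev. Qed.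

(* Mirror image of [branching]: [p] is the reversal of a suffix of [u]. *)
Let rbranching p x := branching (rev T) (rev v) (rev b) p (rev x).

(** Dropping [T'], which has no outgoing edge, keeps the edge count and supplies the [x != T'] that
    [left_maximal_branching] asks for. *)
Let M' := [seq x <- maximals T' | x != T'].
Let R := [seq p <- prefixes (rev u) | has (rbranching p) M'].

Let uniq_M' : uniq M'. Proof. by rewrite filter_uniq ?uniq_maximals. Qed.
Let mem_M' x : x \in M' -> [/\ left_maximal T' x, right_maximal T' x & x != T'].
Proof. by rewrite mem_filter mem_maximals => /andP[? /andP[]]. Qed.

Lemma right_degree_le x :
  D T' x <= (if right_maximal T x then D T x else 1)
            + count (fun p => rbranching p x) (prefixes (rev u)).
Proof.
rewrite !D_rev -left_maximal_rev -rev_T'; exact: left_degree_le.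
Qed.

(** After exchanging the sums, each [p] in [R] counts at most one [x] by [branching_inj], and any
    other [p] counts none. *)
Lemma sum_count_rbranching :
  \sum_(x <- M') count (fun p => rbranching p x) (prefixes (rev u)) <= size R.
Proof.
under eq_bigr do rewrite -sum1_count big_mkcond.
rewrite exchange_big /R size_filter -sum1_count [leqRHS]big_mkcond.
apply: leq_sum => p _; rewrite -big_mkcond sum1_count -size_filter.
case: ifPn => [_ | ]; last by rewrite has_filter negbK => /eqP->.
case eq_s: [seq x <- M' | rbranching p x] => [|x [|y s]] //.
have := filter_uniq (rbranching p) uniq_M'; rewrite eq_s /= inE negb_or.
have: x \in [seq x <- M' | rbranching p x] by rewrite eq_s mem_head.
have: y \in [seq x <- M' | rbranching p x] by rewrite eq_s !inE eqxx orbT.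
rewrite !mem_filter => /andP[br_y _] /andP[br_x _].
by rewrite (inv_inj revK (branching_inj br_x br_y)) eqxx.
Qed.

(** By the mirror image of [left_maximal_branching], each such [x] contributes at least 1 to the
    preceding sum. *)
Lemma count_new_right_maximal :
  count (fun x => ~~ right_maximal T x) M' <= size R.
Proof.
apply: leq_trans sum_count_rbranching; rewrite -sum1_count big_mkcond !big_seq.
apply: leq_sum => x /mem_M'[left_x right_x x_neq].
case: ifPn => // x_nright; rewrite -has_count.
apply: left_maximal_branching; rewrite ?rev_T' ?left_maximal_rev //; right.
by rewrite right_maximal_rev (inj_eq (inv_inj revK)).
Qed.

Lemma R_left_maximal p : p \in R -> suffix (rev p) u /\ left_maximal T' (rev p).
Proof.
rewrite mem_filter mem_prefixes => /andP[/hasP[x /mem_M'[left_x _ _]]].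
case/and4P=> _ p_x _ _ p_u; split; first by rewrite suffix_revLR.
by apply: left_maximal_prefix left_x _; rewrite prefix_revLR.
Qed.

(** Those [rev p] left-maximal in [T] inject into [maximals T] by closure. Each of the others became
    left-maximal through the edit, so it is branching at some [q], which is a prefix of [v] and a
    suffix of [u]; the closures of these [q] give a second injection. *)
Lemma size_R : size R <= 2 * size (maximals T).
Proof.
rewrite -(count_predC (fun p => left_maximal T (rev p)) R) mul2n -addnn.
have suffix_u_T r : suffix r u -> infix r T.
  by move/suffix_prefix_trans; apply.
apply: leq_add; rewrite -size_filter -!sum1_size.
  apply: (leq_sum_relation (R := fun p y => closure_of T (rev p) y)).
  - by rewrite !filter_uniq ?uniq_prefixes.
  - move=> p; rewrite mem_filter => /andP[left_p /R_left_maximal[p_u _]].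
    have [y max_y clo_y] := closure_exists (suffix_u_T _ p_u).
    by exists y; rewrite ?mem_maximals.
  move=> p1 p2 y; rewrite mem_filter => /andP[left1 /R_left_maximal[p1_u _]].
  rewrite mem_filter => /andP[left2 /R_left_maximal[p2_u _]].
  move=> clo1 clo2; apply: (inv_inj revK).
  exact: closure_inj_suffix (prefixW u_T) p1_u p2_u left1 left2 clo1 clo2.
apply: (leq_sum_relation (R := fun p y => exists q,
  [/\ prefix q v, suffix q u, branching T u b q (rev p) & closure_of T q y])).
- by rewrite !filter_uniq ?uniq_prefixes.
- move=> p; rewrite mem_filter => /andP[nleft_p /R_left_maximal[p_u left_p]].
  have p_T := suffix_u_T _ p_u.
  have := left_maximal_branching u_T v_T size_b left_p nleft_p (or_introl p_T).
  case/hasP=> q; rewrite mem_prefixes => q_v br_q.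
  have q_p : suffix q (rev p) by case/and4P: br_q.
  have [y max_y clo_y] := closure_exists (suffix_infix_trans q_p p_T).
  exists y; rewrite ?mem_maximals //; split=> //; exists q.
  by split=> //; apply: suffix_trans p_u.
move=> p1 p2 y _ _ [q1 [q1_v q1_u br1 clo1]] [q2 [q2_v q2_u br2 clo2]].
have eq_q := closure_inj_border (suffixW v_T) q1_v q2_v q1_u q2_u clo1 clo2.
by apply: (inv_inj revK); apply: branching_inj br1 _; rewrite eq_q.
Qed.

(** The [x] that are maximal in [T] contribute at most [cdawg_size T]. Any other [x] is branching at
    a right-maximal suffix [q]; passing to [q] and then to its closure never lowers the degree, and
    this map is injective. *)
Lemma sum_old_right_maximal :
  \sum_(x <- M' | right_maximal T x) D T x <= 2 * cdawg_size T.
Proof.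
rewrite (bigID (left_maximal T)) mul2n -addnn.
apply: leq_add; rewrite -big_filter /cdawg_size -[leqRHS]big_filter -/(maximals T).
  apply: (leq_sum_relation (R := eq)); first by rewrite filter_uniq.
  - move=> x; rewrite mem_filter => /andP[/andP[right_x left_x] _].
    by exists x; rewrite // mem_maximals /maximal left_x.
  - by move=> x1 x2 y _ _ -> ->.
apply: (leq_sum_relation (R := fun x y => exists q,
  [/\ prefix q v, right_maximal T q, branching T u b q x & closure_of T q y])).
- by rewrite filter_uniq.
- move=> x; rewrite mem_filter => /andP[/andP[right_x x_nleft]].
  case/mem_M'=> left_x right_x' x_neq.
  have /andP[x_T _] := right_x.
  have := left_maximal_branching u_T v_T size_b left_x x_nleft (or_introl x_T).
  case/hasP=> q; rewrite mem_prefixes => q_v br_q.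
  have q_x : suffix q x by case/and4P: br_q.
  have right_q := right_maximal_suffix right_x q_x.
  have [y max_y clo_y] := closure_exists (suffix_infix_trans q_x x_T).
  exists y; rewrite ?mem_maximals //; split; first by exists q.
  apply: leq_trans (closure_D right_q clo_y).
  apply/subset_leq_card/subsetP=> a; rewrite !inE.
  by apply: suffix_infix_trans; rewrite suffix_rcons eqxx.
move=> x1 x2 y _ _ [q1 [q1_v right1 br1 clo1]] [q2 [q2_v right2 br2 clo2]].
have eq_q := closure_inj_prefix (suffixW v_T) q1_v q2_v right1 right2 clo1 clo2.
by apply: branching_inj br1 _; rewrite eq_q.
Qed.

Lemma cdawg_size_edit : cdawg_size T' <= 6 * cdawg_size T + 4.
Proof.
have D_self : D T' T' = 0.
  apply/eqP; rewrite cards_eq0; apply/eqP/setP=> a; rewrite !inE.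
  by apply/negP=> /size_infix; rewrite size_rcons ltnn.
have -> : cdawg_size T' = \sum_(x <- M') D T' x.
  rewrite /cdawg_size -big_filter -/(maximals T') [RHS]big_filter.
  rewrite [RHS]big_mkcond; apply: eq_bigr => x _.
  by case: eqP => [->|].
(* Three kinds of edges: old ones out of words right-maximal in [T], one for each other word, and
   those charged to [rbranching]. *)
apply: (@leq_trans (\sum_(x <- M' | right_maximal T x) D T x
  + count (fun x => ~~ right_maximal T x) M'
  + \sum_(x <- M') count (fun p => rbranching p x) (prefixes (rev u)))).
  rewrite -sum1_count [X in X + _ + _]big_mkcond [X in _ + X + _]big_mkcond.
  rewrite -!big_split; apply: leq_sum => x _; apply: leq_trans (right_degree_le x) _.
  by rewrite leq_add2r; case: right_maximal => /=; lia.
have := sum_old_right_maximal; have := count_new_right_maximal.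
have := sum_count_rbranching; have := size_R; have := size_maximals T.
set S1 := \sum_(_ <- _) _; set S2 := \sum_(_ <- _ | _) _; lia.
Qed.
End EditBound.
End Strings.

Theorem theorem1 (Sigma : finType) (n : nat) (T T' : seq Sigma) :
  size T = n -> ed1 T T' ->
  (cdawg_size T' <= 8 * cdawg_size T + 4)%N /\
  ((cdawg_size T')%:R / (cdawg_size T)%:R
     <= (8 * cdawg_size T + 4)%:R / (cdawg_size T)%:R :> rat)%R.
Proof.
move=> _ ed_T; suff bound : (cdawg_size T' <= 8 * cdawg_size T + 4)%N.
  (* For empty [T] the denominator is 0 and its inverse is 0 by convention, which is still
     nonnegative. *)
  by split=> //; rewrite ler_wpM2r ?invr_ge0 ?ler0n // ler_nat.
apply: (@leq_trans (6 * cdawg_size T + 4)); last by lia.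
case: ed_T => u [v [a [b [[-> ->] | [[-> ->] | [-> [-> _]]]]]]].
- exact: (@cdawg_size_edit _ u [:: a] [::] v).
- exact: (@cdawg_size_edit _ u [::] [:: a] v).
- exact: (@cdawg_size_edit _ u [:: b] [:: a] v).
Qed.
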